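(* For every ordinal $\alpha$ with $1<\alpha<\omega_1$ and every monotone sequential contour $\mathcal{V}$ of rank $\alpha$, the minimum of the cardinalities of filter bases of $\mathcal{V}$ equals $\mathfrak{d}$.
   Context: $\mathfrak{d}$ is the dominating number: the least cardinality of a family $\mathcal{F}$ of functions $\omega\to\omega$ such that every $g:\omega\to\omega$ is eventually dominated by some $f\in\mathcal{F}$. A cascade is a tree $V$ without infinite branches and with least element $\emptyset_V$; $v^+$ is the set of immediate successors of $v$, $v^\uparrow$ the subcascade of $v$ and everything above it; $V$ is sequential if each non-maximal $v^+$ is countably infinite. Ranks: $r(v)=0$ for maximal $v$, else least ordinal greater than all $r(w)$, $w\in v^+$; $r(V)=r(\emptyset_V)$. Monotone: each $v^+$ can be enumerated $(v_k)$ with non-decreasing ranks. The contour $\int V$ is the filter on $\max V$: principal at $v$ for maximal $v$; otherwise $\int v^\uparrow=\{A\subseteq\max v^\uparrow: A\cap\max v_k^\uparrow\in\int v_k^\uparrow$ for all but finitely many $k\}$; $\int V=\int\emptyset_V^\uparrow$. A monotone sequential contour of rank $\alpha$ is a filter of the form $\int V$ with $V$ a monotone sequential cascade of rank $\alpha$ (rank is well defined). *)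

(* Defs.v *)
From mathcomp Require Import all_boot all_order.
From mathcomp Require Import all_classical.

Set Implicit Arguments.
Unset Strict Implicit.
Unset Printing Implicit Defensive.

Import Order.TTheory.
Local Open Scope classical_set_scope.
Local Open Scope card_scope.

(* [osup f] denotes the least ordinal strictly greater than every [f i]; in
   particular [osup] of an empty family is 0, and every ordinal is the [osup]
   of the family of its elements. Distinct terms may denote the same ordinal:
   equality of ordinals is [oeq], not Leibniz equality. *)
Inductive Ord : Type := osup (I : Type) (f : I -> Ord).

Fixpoint ole (a b : Ord) {struct a} : Prop :=
  match a with osup A f =>
    forall i : A, match b with osup B g => exists j : B, ole (f i) (g j) end
  end.

Definition olt (a b : Ord) : Prop :=
  match b with osup B g => exists j : B, ole a (g j) end.

Definition oeq (a b : Ord) : Prop := ole a b /\ ole b a.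

Lemma ole_refl a : ole a a.
Proof. by elim: a => A f IH /= i; exists i. Qed.

Definition ozero : Ord := osup (fun x : False => match x with end).
Definition oone : Ord := osup (fun _ : unit => ozero).

(* [omega_1] is the first uncountable ordinal, so [a < omega_1] says that the
   set of all [b < a] is countable. *)
Definition olt_omega1 (a : Ord) : Prop :=
  exists s : nat -> Ord, forall b, olt b a -> exists n, oeq b (s n).

Section Posets.
Context {d : Order.disp_t} {V : porderType d}.
Implicit Types (v w : V) (B C : set V).

Definition chain B : Prop := total_on B (fun x y => (x <= y)%O).

Definition branch B : Prop :=
  chain B /\ forall C, chain C -> B `<=` C -> C `<=` B.

Definition is_tree : Prop :=
  forall v B, B `<=` [set w | (w < v)%O] -> B !=set0 ->
    exists2 m, B m & forall w, B w -> (m <= w)%O.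

Definition max_elts : set V := [set v | forall w, ~ (v < w)%O].

(* [v^+] *)
Definition succs v : set V :=
  [set w | (v < w)%O /\ forall u, ~ ((v < u)%O /\ (u < w)%O)].

(* [max v^\uparrow] *)
Definition max_above v : set V := max_elts `&` [set w | (v <= w)%O].

End Posets.

(* The least element is the [\bot] of the underlying poset. *)
Record cascade (d : Order.disp_t) := Cascade {
  cascade_sort :> bPOrderType d;
  cascade_tree : @is_tree d cascade_sort;
  cascade_branch : forall B : set cascade_sort, branch B -> finite_set B }.

Section CascadeRank.
Context {d : Order.disp_t}.
Implicit Type V : cascade d.

Lemma cascade_wf V : well_founded (fun w v : V => succs v w).
Proof.
move=> v0; apply: contrapT => nA0.
pose R (w v : V) := succs v w.
have step (v : {v : V | ~ Acc R v}) :
    {w : {v : V | ~ Acc R v} | R (sval w) (sval v)}.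
  apply: cid; case: v => v nA /=; apply: contrapT => nex; apply: nA.
  constructor=> w wv; apply: contrapT => nAw; apply: nex.
  by exists (exist _ w nAw).
pose s n : V := sval (iter n (fun v => sval (step v)) (exist _ v0 nA0)).
have s_lt n : (s n < s n.+1)%O.
  by rewrite /s iterS; case: (step _) => w [].
have s_mono : {homo s : m n / (m < n)%N >-> (m < n)%O}.
  by apply: homo_ltn => // x y z; exact: lt_trans.
have s_inj : injective s.
  by move=> m n; case: (ltngtP m n) => // /s_mono + e; rewrite e ltxx.
have chain_s : chain (range s).
  move=> _ _ [m _ <-] [n _ <-].
  by case: (ltngtP m n) => [/s_mono/ltW|/s_mono/ltW|->]; [left|right|left].
have [|M [chM maxM]] := @Zorn_bigcup V (fun C => chain (C `|` range s)).
  move=> F FP totF x y; case=> [[C FC Cx]|sx]; case=> [[D FD Dy]|sy].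
  - case: (totF C D FC FD) => [CD|DC].
      by apply: (FP D FD); left => //; exact: CD.
    by apply: (FP C FC); left => //; exact: DC.
  - by apply: (FP C FC); [left|right].
  - by apply: (FP D FD); [right|left].
  - exact: chain_s.
have brM : branch (M `|` range s).
  split=> // C chC sub x Cx; left; apply: contrapT => nMx; apply: (maxM C).
    split; first by move=> y My; apply: sub; left.
    by move/(_ x Cx).
  move=> y z [Cy|sy] [Cz|sz]; apply: chC => //; by apply: sub; right.
have finS : finite_set (range s).
  by apply: sub_finite_set (cascade_branch brM) => x; right.
apply: infinite_nat; rewrite -(eq_finite_set (inj_card_eq (f := s) _)) //.
by move=> m n _ _; exact: s_inj.
Qed.

Fixpoint rank_acc (T : Type) (R : T -> T -> Prop) (v : T) (H : Acc R v)
    {struct H} : Ord :=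
  osup (fun w : {w : T | R w v} => rank_acc (Acc_inv H (proj2_sig w))).

Definition rank V (v : V) : Ord := rank_acc (cascade_wf v).

Lemma rank_gt V (v w : V) : succs v w -> olt (rank w) (rank v).
Proof.
rewrite /rank => vw; case: (cascade_wf v) => a /=.
exists (exist _ w vw) => /=.
by rewrite (Prop_irrelevance (cascade_wf w) (a w vw)); exact: ole_refl.
Qed.

Lemma rank_least V (v : V) (b : Ord) :
  (forall w, succs v w -> olt (rank w) b) -> ole (rank v) b.
Proof.
rewrite /rank => vb; case: (cascade_wf v) => a /= [w vw] /=.
by move: (vb w vw); rewrite (Prop_irrelevance (cascade_wf w) (a w vw)).
Qed.

Definition cascade_rank V : Ord := rank (\bot%O : V).

Definition sequential V : Prop :=
  forall v : V, ~ max_elts v -> succs v #= [set: nat].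

Definition monotone V : Prop :=
  forall v : V, ~ max_elts v -> exists e : nat -> V,
    set_bij [set: nat] (succs v) e /\
    forall m n, (m <= n)%N -> ole (rank (e m)) (rank (e n)).

End CascadeRank.

Section Contour.
Context {d : Order.disp_t} (V : cascade d).

(* [contour_at v] is the filter on [max v^\uparrow]. The finite set [E] of
   exceptional successors is named for the sake of strict positivity; see
   [contour_at_succ]. *)
Inductive contour_at : V -> set (set V) :=
| ContourMax v A : max_elts v -> A `<=` max_above v -> A v -> contour_at v A
| ContourSucc v A (E : set V) : ~ max_elts v -> A `<=` max_above v ->
    finite_set E ->
    (forall w, succs v w -> ~ E w -> contour_at w (A `&` max_above w)) ->
    contour_at v A.

Lemma contour_at_max v A : max_elts v ->
  contour_at v A <-> A `<=` max_above v /\ A v.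
Proof.
move=> mv; split=> [cA|[sA Av]]; last exact: ContourMax.
by case: cA mv.
Qed.

Lemma contour_at_succ v A : ~ max_elts v ->
  contour_at v A <->
  A `<=` max_above v /\
  finite_set [set w | succs v w /\ ~ contour_at w (A `&` max_above w)].
Proof.
move=> nmv; split=> [cA|[sA finE]].
  case: cA nmv => [{}v {}A mv //|{}v {}A E _ sA finE cE nmv]; split=> //.
  apply: sub_finite_set finE => w [vw ncw].
  by apply: contrapT => nEw; exact: ncw (cE w vw nEw).
apply: ContourSucc nmv sA finE _ => w vw nE.
by apply: contrapT => ncw; exact: nE.
Qed.

Definition contour : set (set V) := contour_at \bot%O.

End Contour.

Arguments contour {d} V.

Definition filter_base (T : Type) (F B : set (set T)) : Prop :=
  B `<=` F /\ forall A, F A -> exists2 C, B C & C `<=` A.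

Definition dominating (D : set (nat -> nat)) : Prop :=
  forall g : nat -> nat, exists2 f, D f & \forall n \near \oo, (g n <= f n)%N.

(* The least cardinality of a set satisfying [P] is attained and equals the
   cardinality of [K]. *)
Definition least_card (T U : Type) (P : set T -> Prop) (K : set U) : Prop :=
  (exists2 A, P A & A #= K) /\ forall A, P A -> K #<= A.

(* Main.v *)
(* Enumerate the successors of every non-maximal v as (e v k)_k. For
   phi : V -> nat, the set of those maximal x such that e u k <= x forces
   phi u <= k belongs to the contour, and every element of the contour contains
   such a set. As V is countable, a dominating family D, corrected by constants
   to dominate everywhere, yields a base indexed by D * nat; and D * nat has the
   cardinality of D. Conversely the rank exceeds 1, so by monotonicity almost all
   successors (e bot n) are non-maximal. Given a base B, send C in B to a
   function mapping n to some k such that C meets the cone above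
   e (e bot n) k: if C avoids these cones for k < g n, the function
   eventually dominates g. *)
Require Import Defs.
From mathcomp Require Import all_boot all_order.
From mathcomp Require Import all_classical.

Set Implicit Arguments.
Unset Strict Implicit.
Unset Printing Implicit Defensive.

Import Order.TTheory.
Local Open Scope classical_set_scope.
Local Open Scope card_scope.

(** * Cardinal arithmetic and least cardinalities *)

Lemma infinite_card_setX_nat (T : pointedType) (A : set T) :
  infinite_set A -> A `*` [set: nat] #<= A.
Proof.
move=> infA.
(* A maximal family of injective sequences in [A] with disjoint ranges covers
   [A] up to a finite set. *)
pose P (S : set (nat -> T)) := forall s t i j, S s -> S t ->
  A (s i) /\ (s i = t j -> s = t /\ i = j).
have [F FP totF|S [PS maxS]] := @Zorn_bigcup _ P.
  move=> s t i j [X FX Xs] [Y FY Yt].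
  case: (totF X Y FX FY) => sub; [apply: (FP Y FY)|apply: (FP X FX)] => //;
    exact: sub.
pose L := A `\` [set x | exists s i, S s /\ s i = x].
have finL : finite_set L.
  apply: contrapT => /infiniteP/pcard_leP[f].
  have fL i : L (f i) by apply: funS.
  have finj i j : f i = f j -> i = j by apply: inj; rewrite in_setT.
  have fS s i j : S s -> s i <> f j.
    by move=> Ss sf; case: (fL j) => _; apply; exists s, i.
  apply: (maxS (S `|` [set (f : nat -> T)])).
    split; first by left.
    by move=> /(_ f (or_intror erefl)) Sf; exact: (fS _ 0 0 Sf).
  move=> s t i j [Ss|->] [St|->]; first exact: PS.
  - by split=> [|/(fS _ _ _ Ss)//]; have [] := PS s s i i Ss Ss.
  - by split=> [|/esym/(fS _ _ _ St)//]; have [] := fL i.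
  - by split=> [|/finj//]; have [] := fL i.
have [s0 Ss0] : S !=set0.
  apply/set0P/eqP => S0; apply: infA; apply: sub_finite_set finL => x Ax.
  by split=> // -[s [i [Ss _]]]; rewrite S0 in Ss.
have : countable ((range s0 `|` L) `*` [set: nat]).
  apply: countableX => //; rewrite -bigcup2E; apply: bigcup_countable => //.
  move=> [|[|i]] _ //=; last exact: finite_set_countable.
  exact: card_image_le.
move=> /pcard_surjP[q qS].
pose dec n : nat * nat := odflt (0, 0) (choice.unpickle n).
(* The image of [A] under [g] covers [A * nat]: the range of [s0] yields, through [q], all pairs
   over [range s0] and the leftover [L]; the range of any other [s] in [S] yields [range s * nat]
   through the decoding [dec]. *)
pose g x := let p := xget (s0, 0) [set p | S p.1 /\ p.1 p.2 = x] in
  if `[<p.1 = s0>] then q p.2 else (p.1 (dec p.2).1, (dec p.2).2).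
have gE s i : S s -> g (s i) =
    if `[<s = s0>] then q i else (s (dec i).1, (dec i).2).
  move=> Ss; rewrite /g.
  have := @xgetI _ (s0, 0) [set p | S p.1 /\ p.1 p.2 = s i] (s, i).
  move=> /(_ (conj Ss erefl)).
  by case: xget => t j /= [St]; case: (PS t s j i St Ss) => _ /[apply] -[-> ->].
apply: card_le_trans (card_image_le g A); apply: subset_card_le => -[x n] [/= Ax _].
have [[s [i [Ss <-]]]|nx] := pselect (exists s i, S s /\ s i = x); last first.
  have [|k _ <-] := qS (x, n); first by split=> //; right.
  exists (s0 k); first by have [] := PS s0 s0 k k Ss0 Ss0.
  by rewrite gE//; case: asboolP.
have [e|ne] := pselect (s = s0).
  have [|k _ <-] := qS (s i, n); first by split=> //; left; exists i; rewrite ?e.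
  exists (s0 k); first by have [] := PS s0 s0 k k Ss0 Ss0.
  by rewrite gE//; case: asboolP.
pose j := choice.pickle (i, n).
exists (s j); first by have [] := PS s s j j Ss Ss.
by rewrite gE//; case: asboolP => // _; rewrite /dec choice.pickleK.
Qed.

Lemma least_card_exists (T : pointedType) (P : set T -> Prop) (A0 : set T) :
  P A0 -> exists2 A, P A & forall B, P B -> A #<= B.
Proof.
move=> PA0.
(* Zorn's lemma on sets of choice functions on [P] with injective evaluations:
   if no evaluation on a maximal [S] were onto, [S] could be extended. *)
pose Q (S : set (set T -> T)) := forall A, P A ->
  (forall c, S c -> A (c A)) /\ forall c c', S c -> S c' -> c A = c' A -> c = c'.
have [F FQ totF|S [QS maxS]] := @Zorn_bigcup _ Q.
  move=> A PA; split=> [c [X FX Xc]|c c' [X FX Xc] [Y FY Yc']].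
    by have [+ _] := FQ X FX A PA; exact.
  by case: (totF X Y FX FY) => sub;
    [have [_] := FQ Y FY A PA|have [_] := FQ X FX A PA]; apply=> //; exact: sub.
have Sle B : P B -> S #<= B.
  move=> PB; have [cB injB] := QS B PB.
  apply/pcard_leP/injfunPex; exists (fun c => c B) => // c c'.
  by move=> /set_mem + /set_mem; exact: injB.
have [A PA Asub] : exists2 A, P A & A `<=` (fun c => c A) @` S.
  apply: contrapT => nA.
  have /choice[c cP] :
      forall A, exists x, P A -> A x /\ forall c, S c -> c A <> x.
    move=> A; apply: contrapT => nx; apply: nA; exists A.
      by apply: contrapT => nPA; apply: nx; exists point.
    move=> x Ax; apply: contrapT => nS; apply: nx; exists x => _; split=> // c Sc cx.
    by apply: nS; exists c.
  apply: (maxS (S `|` [set c])).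
    split; first by left.
    move=> /(_ c (or_intror erefl)) Sc.
    by case: (cP A0 PA0) => _ /(_ c Sc).
  move=> A PA; have [cA injA] := QS A PA; have [Ac ncA] := cP A PA.
  split=> [c' [/cA//|->//]|c1 c2 [S1|->] [S2|->] //].
  - exact: injA.
  - by move/(ncA _ S1).
  - by move/esym/(ncA _ S2).
exists A => // B PB; apply: card_le_trans (Sle B PB).
exact: card_le_trans (subset_card_le Asub) (card_image_le _ _).
Qed.

(** * Dominating families *)

(** The successor of the sum of finitely many functions exceeds each of them everywhere. *)
Lemma dominating_infinite (D : set (nat -> nat)) : dominating D -> infinite_set D.
Proof.
move=> domD /finite_seqP[s Ds].
have [f] := domD (fun n => (\sum_(h <- s) h n).+1).
rewrite Ds /= => fs [N _ /(_ N (leqnn N))] /=.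
by rewrite (big_rem f)//= ltnNge leq_addr.
Qed.

Lemma dominating_setT : dominating [set: nat -> nat].
Proof. by move=> g; exists g => //; exists 0. Qed.

Lemma dominating_everywhere (D : set (nat -> nat)) (g : nat -> nat) :
  dominating D -> exists2 f, D f & exists M, forall n, g n <= f n + M.
Proof.
(* The constant sums [g] over the finitely many arguments where domination may fail. *)
move=> /(_ g)[f Df [N _ gf]]; exists f => //; exists (\sum_(i < N) g i) => n.
have [nN|/gf /leq_trans-> //] := ltnP n N; last exact: leq_addr.
by rewrite (bigD1 (Ordinal nN))//= addnCA leq_addr.
Qed.

Lemma ole_trans (a b c : Ord) : ole a b -> ole b c -> ole a c.
Proof.
elim: a b c => I f IH [J g] [K h] /= fg gh i.
by have [j fgi] := fg i; have [k ghj] := gh j; exists k; exact: IH ghj.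
Qed.

(** * Order structure of cascades *)

Section CascadeTree.
Context {d : Order.disp_t} (V : cascade d).
Implicit Types (u v w x : V) (C : set V).
Local Open Scope order_scope.
Local Open Scope classical_set_scope.

Lemma succs_lt v w : succs v w -> v < w.
Proof. by case. Qed.

(** The least element strictly between [v] and [x] is a successor of [v]; if there is none, [x] is
    one. *)
Lemma succs_below v x : v < x -> exists2 w, succs v w & w <= x.
Proof.
move=> vx; have [vx'|nvx] := pselect (succs v x); first by exists x.
have [| |w [vw wx] wmin] := @cascade_tree _ V x [set u | v < u /\ u < x].
- by move=> u [].
- by apply: contrapT => nu; apply: nvx; split=> // u uP; apply: nu; exists u.
exists w; last exact: ltW.
split=> // u [vu uw]; have := wmin u (conj vu (lt_trans uw wx)).
by move=> /(lt_le_trans uw); rewrite ltxx.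
Qed.

Lemma comparable_below u v x : u <= x -> v <= x -> u <= v \/ v <= u.
Proof.
rewrite le_eqVlt => /orP[/eqP->|ux]; first by right.
rewrite le_eqVlt => /orP[/eqP->|vx]; first by left; exact: ltW.
have [| |w [->|->] wmin] := @cascade_tree _ V x [set u; v].
- by move=> w [->|->].
- by exists u; left.
- by left; apply: wmin; right.
- by right; apply: wmin; left.
Qed.

(** Makes the cones above distinct successors disjoint: elements below [x] are comparable, and no
    successor of [v] lies strictly below another. *)
Lemma succs_below_inj v w w' x :
  succs v w -> succs v w' -> w <= x -> w' <= x -> w = w'.
Proof.
move=> vw vw' wx w'x.
have H a b : succs v a -> succs v b -> a <= b -> a = b.
  move=> va vb; rewrite le_eqVlt => /orP[/eqP//|ab].
  by case: vb => _ /(_ a); case; split=> //; exact: succs_lt.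
by case: (comparable_below wx w'x) => [|/H<-//]; exact: H.
Qed.

Lemma max_eltsPn v : ~ max_elts v -> exists w, succs v w.
Proof.
move=> nmv; apply: contrapT => nw; apply: nmv => x /succs_below[w vw _].
by apply: nw; exists w.
Qed.

Lemma cascade_ind (P : V -> Prop) :
  (forall v, (forall w, succs v w -> P w) -> P v) -> forall v, P v.
Proof. by move=> IH v; elim: (cascade_wf v) => {}v _; exact: IH. Qed.

Lemma le_succs_max_above v w : succs v w -> max_above w `<=` max_above v.
Proof. by move=> /succs_lt/ltW vw x [mx wx]; split=> //; exact: le_trans wx. Qed.

Lemma max_elts_le v w : max_elts v -> v <= w -> w = v.
Proof. by move=> mv; rewrite le_eqVlt => /orP[/eqP//|/mv]. Qed.

Lemma contour_at_sub v C : contour_at v C -> C `<=` max_above v.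
Proof. by case. Qed.

(** By induction, the cone above [v] is [v] together with countably many countable cones. *)
Lemma cascade_countable : sequential V -> countable [set: V].
Proof.
move=> seqV; suff : countable [set x | (\bot : V) <= x].
  by apply: card_le_trans; apply: subset_card_le => x _ /=; exact: le0x.
move: (\bot : V); apply: cascade_ind => v IH.
have [mv|/seqV vN] := pselect (max_elts v).
  apply: sub_countable (countable1 v); apply: subset_card_le => x /=.
  exact: max_elts_le.
have : countable ([set v] `|` \bigcup_(w in succs v) [set x | w <= x]).
  rewrite -bigcup2E; apply: bigcup_countable => // -[|[|i]] _ //=.
  by apply: bigcup_countable => //; rewrite (eq_countable vN).
apply: sub_countable; apply: subset_card_le => x /=.
rewrite le_eqVlt => /orP[/eqP->|/succs_below[w vw wx]]; first by left.
by right; exists w.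
Qed.

Lemma contour_at_nonempty v C : sequential V -> contour_at v C -> C !=set0.
Proof.
move=> seqV; elim=> [{}v {}C _ _ Cv|{}v {}C E nmv _ finE _ IH]; first by exists v.
have [w [vw nEw]] : succs v `\` E !=set0.
  apply: infinite_setN0; apply: infinite_setD => //.
  by rewrite (eq_finite_set (seqV v nmv)); exact: infinite_nat.
by have [x [Cx _]] := IH w vw nEw; exists x.
Qed.

(** * Tails, the basic sets of the contour *)

(** Relativized to the cone above [v], for induction along the cascade. *)
Definition tail (e : V -> nat -> V) (phi : V -> nat) v : set V :=
  [set x | max_above v x /\ forall u k, v <= u -> ~ max_elts u ->
    e u k <= x -> (phi u <= k)%N].

Section Tail.
Variable e : V -> nat -> V.
Hypothesis e_bij : forall v, ~ max_elts v -> set_bij [set: nat] (succs v) (e v).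

Let e_succs v k : ~ max_elts v -> succs v (e v k).
Proof. by move=> /e_bij[eS _ _]; exact: eS. Qed.

Let e_inj v i j : ~ max_elts v -> e v i = e v j -> i = j.
Proof. by move=> /e_bij[_ + _] => /(_ i j); rewrite !in_setT => /(_ isT isT). Qed.

Let e_surj v w : ~ max_elts v -> succs v w -> exists k, e v k = w.
Proof. by move=> /e_bij[_ _ eS] /eS[k _ <-]; exists k. Qed.

(** Passing to [e v k] drops only the constraint at [v]. That constraint holds throughout the cone,
    as [e v k] is the only successor of [v] below its points and [phi v <= k]. *)
Lemma tail_succs phi v k : ~ max_elts v -> (phi v <= k)%N ->
  tail e phi v `&` max_above (e v k) = tail e phi (e v k).
Proof.
move=> nmv phik; have vk := e_succs k nmv.
apply/seteqP; split=> x [].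
  move=> [vx xP] kx; split=> // u j ku; apply: xP.
  exact: le_trans (ltW (succs_lt vk)) ku.
move=> kx xP; split=> //; split; first exact: (le_succs_max_above vk kx).
move=> u j vu nmu jx; have [euv|uv] := eqVneq v u.
  rewrite -euv in jx *.
  suff -> : j = k by [].
  apply: (e_inj nmv); apply: (succs_below_inj (x := x) (e_succs j nmv) vk) => //.
  by case: kx.
have {}vu : v < u by rewrite lt_neqAle uv.
have [w vw wu] := succs_below vu; have ux : u <= x.
  by apply: le_trans jx; exact: ltW (succs_lt (e_succs j nmu)).
have kw : w = e v k.
  by apply: (succs_below_inj (x := x) vw vk) => //; [exact: le_trans ux|case: kx].
by apply: xP => //; rewrite -kw.
Qed.

Lemma contour_at_tail phi v : contour_at v (tail e phi v).
Proof.
elim/cascade_ind: v => v IH; have [mv|nmv] := pselect (max_elts v).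
  apply: ContourMax => //; first by move=> x [].
  by split=> [|u k vu]; [split=> //=|rewrite (max_elts_le mv vu)].
(* The exceptional successors are those of index below [phi v]. *)
apply: (ContourSucc (E := e v @` `I_(phi v))) => //; first by move=> x [].
  exact: finite_image.
move=> w vw nEw; have [k kw] := e_surj nmv vw.
rewrite -kw tail_succs//; first by rewrite kw; exact: IH.
by rewrite leqNgt; apply/negP => kphi; apply: nEw; exists k.
Qed.

Lemma contour_at_cofinite u C : ~ max_elts u -> contour_at u C ->
  exists N, forall k, (N <= k)%N -> contour_at (e u k) (C `&` max_above (e u k)).
Proof.
move=> nmu /(contour_at_succ _ nmu)[_ finE].
suff /finite_seqP[s sE] : finite_set
    [set k | ~ contour_at (e u k) (C `&` max_above (e u k))].
  exists (\max_(k <- s) k).+1 => k; apply: contraPP => nk.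
  have ks : k \in s by have : [set` s] k by rewrite -sE.
  by apply/negP; rewrite -leqNgt; apply: (leq_bigmax_seq (F := id)).
apply: sub_finite_set (finite_preimage (f := e u) _ finE).
  by move=> k /= nk; split=> //; exact: e_succs.
by move=> i j _ _; exact: e_inj.
Qed.

(** With [phi u] the threshold of [contour_at_cofinite], the trace of [C] stays in the contours
    along the path to a point [x] of the tail; at [x] the contour is principal, so [x] is in [C].
    One [phi] serves all [v], as the induction requires. *)
Lemma contour_at_contains_tail C :
  exists phi, forall v, contour_at v (C `&` max_above v) -> tail e phi v `<=` C.
Proof.
have /choice[phi phiP] : forall u, exists N, ~ max_elts u ->
    contour_at u (C `&` max_above u) -> forall k, (N <= k)%N ->
    contour_at (e u k) (C `&` max_above (e u k)).
  move=> u; have [mu|nmu] := pselect (max_elts u); first by exists 0%N.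
  have [cC|nC] := pselect (contour_at u (C `&` max_above u)); last by exists 0%N.
  have [N NP] := contour_at_cofinite nmu cC; exists N => _ _ k /NP.
  by rewrite -setIA (setIidr (le_succs_max_above (e_succs k nmu))).
exists phi; apply: cascade_ind => v IH cC x [[mx vx] xP].
have [mv|nmv] := pselect (max_elts v).
  move/(contour_at_max _ mv): cC => [_ [Cv _]]; by rewrite (max_elts_le mv vx).
have vx' : v < x.
  by rewrite lt_neqAle vx andbT; apply/eqP => vx'; apply: nmv; rewrite vx'.
have [w vw wx] := succs_below vx'; have [k kw] := e_surj nmv vw.
have phik : (phi v <= k)%N by apply: xP => //; rewrite kw.
apply: (IH w vw); first by rewrite -kw; exact: phiP.
rewrite -kw -tail_succs//; split; first by split.
by split=> //; rewrite kw.
Qed.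

End Tail.
End CascadeTree.

(** * Comparing bases with dominating families *)

Lemma rank_gt1_succs (d : Order.disp_t) (V : cascade d) :
  olt oone (cascade_rank V) ->
  exists2 w : V, succs \bot%O w & ole oone (rank w).
Proof.
rewrite /cascade_rank {1}/rank; case: (cascade_wf _) => a /= [[w vw] /= h].
by exists w => //; rewrite /rank (Prop_irrelevance (cascade_wf w) (a w vw)).
Qed.

Lemma rank_ge1_nmax (d : Order.disp_t) (V : cascade d) (w : V) :
  ole oone (rank w) -> ~ max_elts w.
Proof.
rewrite /rank; case: (cascade_wf w) => a /= /(_ tt)[[u wu] _] /(_ u).
by apply; exact: succs_lt.
Qed.

Lemma contour_base_of_dominating (d : Order.disp_t) (V : cascade d)
    (D : set (nat -> nat)) : sequential V -> monotone V -> dominating D ->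
  exists2 B, filter_base (contour V) B & B #<= D.
Proof.
move=> seqV monV domD.
have /choice[e eP] : forall v : V, exists e : nat -> V,
    ~ max_elts v -> set_bij [set: nat] (succs v) e.
  move=> v; have [mv|/monV[e [eP _]]] := pselect (max_elts v); last by exists e.
  by exists (fun=> v).
have /countable_injP[c cinj] := cascade_countable seqV.
pose t (p : (nat -> nat) * nat) := tail e (fun v => p.1 (c v) + p.2) (\bot%O : V).
exists (t @` (D `*` [set: nat])); last first.
  apply: card_le_trans (card_image_le t _) _.
  exact/infinite_card_setX_nat/dominating_infinite.
split=> [_ [p _ <-]|C cC]; first exact: contour_at_tail.
have [phi phiP] := contour_at_contains_tail eP C.
(* The function dominated is [phi] read through the coding [c]; numbers that code no node are sent
   to [phi] of the root. *)
have [f Df [M fM]] := dominating_everywhere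
  (fun n => phi (xget \bot%O [set v | c v = n])) domD.
exists (t (f, M)); first by exists (f, M).
apply: subset_trans (phiP \bot%O _); last first.
  by rewrite setIidl//; exact: contour_at_sub cC.
(* Larger thresholds give smaller tails. *)
move=> x [mx xP]; split=> // u k bu nmu ux; apply: leq_trans (xP u k bu nmu ux).
have /= := fM (c u); case: xgetP => [v _ /cinj|nu]; last by case: (nu u).
by rewrite !in_setT => ->.
Qed.

Lemma dominating_of_contour_base (d : Order.disp_t) (V : cascade d)
    (B : set (set V)) : sequential V -> monotone V ->
  olt oone (cascade_rank V) -> filter_base (contour V) B ->
  exists2 D, dominating D & D #<= B.
Proof.
move=> seqV monV /rank_gt1_succs[w bw rw] [Bsub Bbase].
have nmb : ~ max_elts (\bot%O : V) by move=> /(_ w); apply; exact: succs_lt.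
have /choice[e eP] : forall v : V, exists e : nat -> V,
    ~ max_elts v -> set_bij [set: nat] (succs v) e /\
      forall m n, (m <= n)%N -> ole (rank (e m)) (rank (e n)).
  move=> v; have [mv|/monV[e eP]] := pselect (max_elts v); last by exists e.
  by exists (fun=> v).
have e_bij v (nmv : ~ max_elts v) := (eP v nmv).1.
have [eS einj esurj] := e_bij _ nmb; set b := e \bot%O in eS einj esurj.
(* From the index [m] of [w] on, monotonicity keeps the ranks at least 1. *)
have [m _ mw] := esurj w bw.
have nmax_b n : (m <= n)%N -> ~ max_elts (b n).
  move=> mn; apply: rank_ge1_nmax; apply: ole_trans rw _; rewrite -mw.
  exact: (eP _ nmb).2.
pose F (C : set V) n := xget 0 [set k | exists2 x, C x & (e (b n) k <= x)%O].
exists (F @` B); last exact: card_image_le.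
(* [phi] places the value [g n] at the node [b n], so that a base element inside its tail avoids the
   cones above [e (b n) k] for [k < g n]. *)
move=> g; pose phi v := g (xget 0 [set n | b n = v]).
have phib n : phi (b n) = g n.
  rewrite /phi; case: xgetP => [k _ /einj|nn]; last by case: (nn n).
  by rewrite !in_setT => ->.
have [C BC Cphi] := Bbase _ (contour_at_tail e_bij phi \bot%O).
exists (F C); first by exists C.
have [N NP] := contour_at_cofinite e_bij nmb (Bsub C BC).
(* Beyond [m] the node [b n] has successors, and beyond [N] the set [C] meets the cone above [b n];
   hence [F C n] is a genuine index, not the default 0. *)
exists (maxn m N) => // n /=; rewrite geq_max => /andP[/nmax_b nmn Nn].
have [x [Cx [mx bx]]] := contour_at_nonempty seqV (NP n Nn).
have bx' : (b n < x)%O.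
  by rewrite lt_neqAle bx andbT; apply/eqP => bx'; apply: nmn; rewrite bx'.
have [u bu ux] := succs_below bx'; have [_ _ /(_ u bu)[k _ ku]] := e_bij _ nmn.
rewrite -phib /F; case: xgetP => [j _ [y /Cphi[_ yP] jy]|/(_ k)].
  by apply: yP jy => //; exact: le0x.
by case; exists x => //; rewrite ku.
Qed.

Theorem theorem5p2 (alpha : Ord) (alpha_gt1 : olt oone alpha)
    (alpha_lt_omega1 : olt_omega1 alpha)
    (d : Order.disp_t) (V : cascade d)
    (V_sequential : sequential V) (V_monotone : monotone V)
    (V_rank : oeq (cascade_rank V) alpha) :
  exists D : set (nat -> nat),
    least_card dominating D /\ least_card (filter_base (contour V)) D.
Proof.
have rank_gt1 : olt oone (cascade_rank V).
  case: V_rank => _; case: alpha alpha_gt1 {alpha_lt_omega1} => I f [i fi].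
  by case: (cascade_rank V) => J g /(_ i)[j gj]; exists j; exact: ole_trans gj.
have [D domD leastD] := least_card_exists dominating_setT.
have D_le B : filter_base (contour V) B -> D #<= B.
  move=> /(dominating_of_contour_base V_sequential V_monotone rank_gt1)[E domE].
  exact: card_le_trans (leastD E domE).
exists D; split; split=> //; first by exists D.
have [B baseB BD] := contour_base_of_dominating V_sequential V_monotone domD.
(* Equality of cardinalities by Cantor-Bernstein. *)
by exists B => //; rewrite card_eq_le BD D_le.
Qed.
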